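(* Let $0\neq h\in\mathbb{F}[x]$ and regard $A_h\subseteq A_1$ via $x\mapsto x$, $\hat y\mapsto yh$. (1) If $\mathrm{char}(\mathbb{F})=0$, then the center $Z(A_h)$ is $\mathbb{F}1$. (2) If $\mathrm{char}(\mathbb{F})=p>0$, then $x^p$ and $h^py^p$ are algebraically independent and $Z(A_h)=\mathbb{F}[x^p,h^py^p]$ is a polynomial algebra in these two elements. Moreover $h$ divides $\delta^p(x)$ in $\mathbb{F}[x]$, and $$h^py^p=y^ph^p=\hat y(\hat y+h')(\hat y+2h')\cdots(\hat y+(p-1)h')=\hat y^p-\frac{\delta^p(x)}{h}\,\hat y.$$
   Context: For $h\in\mathbb{F}[x]$, $A_h$ is the unital associative $\mathbb{F}$-algebra generated by $x,\hat y$ with defining relation $\hat yx-x\hat y=h$. $A_1$ is the Weyl algebra, generated by $x,y$ with $yx-xy=1$; for $h\ne0$, $x\mapsto x,\ \hat y\mapsto yh$ embeds $A_h$ into $A_1$. $\delta:\mathbb{F}[x]\to\mathbb{F}[x]$ is the derivation $\delta(f)=hf'$, where $f'$ is the formal derivative, and $\delta^p$ is its $p$-th iterate. *)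

(* Defs.v *)
From HB Require Import structures.
From mathcomp Require Import all_boot all_order all_algebra.
Set Implicit Arguments. Unset Strict Implicit. Unset Printing Implicit Defensive.
Import Order.TTheory GRing.Theory.
Local Open Scope ring_scope.

(* The Weyl algebra A_1 over F, in normal form: an element is
   sum_i a_i(x) y^i  (coefficients a_i in F[x] written on the LEFT of y^i),
   represented by the polynomial sum_i a_i Y^i in {poly {poly F}}.
   Addition and F-scalars are those of {poly {poly F}}; the (non-commutative)
   multiplication is wmul, from  yx - xy = 1, i.e.
   (f y^i)(g y^j) = sum_k C(i,k) f g^(k) y^(i+j-k). *)
Definition weyl (F : fieldType) := {poly {poly F}}.

Definition wmul (F : fieldType) (a b : weyl F) : weyl F :=
  \sum_(i < size a) \sum_(j < size b) \sum_(k < i.+1)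
     ((a`_i * (b`_j)^`(k)) *+ 'C(i, k))%:P * 'X^(i + j - k).

Definition wX (F : fieldType) : weyl F := ('X : {poly F})%:P.
Definition wY (F : fieldType) : weyl F := 'X.
Definition wpoly (F : fieldType) (f : {poly F}) : weyl F := f%:P.
Definition wscal (F : fieldType) (c : F) : weyl F := c%:P%:P.

Definition wexp (F : fieldType) (a : weyl F) (n : nat) : weyl F :=
  iter n (wmul a) 1.
Definition wprod (F : fieldType) (s : seq (weyl F)) : weyl F :=
  foldr (@wmul F) 1 s.

Definition yhat (F : fieldType) (h : {poly F}) : weyl F := wmul (wY F) (wpoly h).

Inductive Ah (F : fieldType) (h : {poly F}) : weyl F -> Prop :=
| Ah_scal c : Ah h (wscal c)
| Ah_x : Ah h (wX F)
| Ah_yhat : Ah h (yhat h)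
| Ah_add a b : Ah h a -> Ah h b -> Ah h (a + b)
| Ah_mul a b : Ah h a -> Ah h b -> Ah h (wmul a b).

Definition center_Ah (F : fieldType) (h : {poly F}) (a : weyl F) : Prop :=
  Ah h a /\ forall b, Ah h b -> wmul a b = wmul b a.

(* evaluation of a bivariate polynomial P(u,v) = sum_{i,j} P_{ij} u^j v^i
   at two elements u, v of A_1 (P : {poly {poly F}}, outer variable <-> v) *)
Definition weval2 (F : fieldType) (P : {poly {poly F}}) (u v : weyl F) : weyl F :=
  \sum_(i < size P) \sum_(j < size P`_i)
     wmul (wscal (P`_i`_j)) (wmul (wexp u j) (wexp v i)).

Definition delta (F : fieldType) (h f : {poly F}) : {poly F} := h * f^`().

(* Main.v *)
Require Import Defs.
From HB Require Import structures.
From mathcomp Require Import all_boot all_order all_algebra.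
Import GRing.Theory.
Local Open Scope ring_scope.
Set Implicit Arguments. Unset Strict Implicit. Unset Printing Implicit Defensive.

(**
  Left multiplication by [y] on normal forms is the operator
  [L b = Y * b + d b / d x], and [a * b = \sum_i a_i * L^i b]; associativity
  of [wmul] follows.  In these terms [a x - x a] is the derivative of [a] in
  [Y] and [y a - a y] its derivative in [x].

  A central element of [A_h] commutes with [x] and with [y h], so both of its
  partial derivatives vanish (the factor [h] cancels).  In characteristic [0]
  it is a scalar.  In characteristic [p] it is a polynomial in [x^p] and [y^p];
  since the [y^i]-coefficient of an element of [A_h] is divisible by [h^i], it
  is even a polynomial in [x^p] and [h^p y^p].

  For the last formula put [D = h y].  Then [ad D] restricts to [delta] on
  [F[x]], and [ad (D^p) = (ad D)^p], so [D^p - (delta^p(x)/h) D] commutes with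
  [x].  Only the powers [y^0] and [y^p] can occur in it, and comparing
  coefficients gives [h^p y^p].  Conjugating by [h], as [h (y h) = D h],
  replaces [D] by [y h].
*)

(** * Binomial expansions and commutators with powers *)

Lemma iter_addr_comm (V : zmodType) (S T : {additive V -> V}) :
  (forall v, S (T v) = T (S v)) -> forall n v,
  iter n (fun u => S u + T u) v =
  \sum_(k < n.+1) iter (n - k) S (iter k T v) *+ 'C(n, k).
Proof.
move=> ST; have STn n v : T (iter n S v) = iter n S (T v).
  by elim: n => //= n <-; rewrite ST.
elim=> [|n IH] v; first by rewrite big_ord_recl big_ord0 /= addr0 bin0.
rewrite iterS IH !raddf_sum /=.
under eq_bigr do rewrite raddfMn /= -iterS -subSn ?leq_ord //.
under [X in _ + X]eq_bigr do rewrite raddfMn /= STn -iterS.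
rewrite [RHS]big_ord_recl /= bin0 /bump /=.
under [X in _ = _ + X]eq_bigr do rewrite add1n binS subSS mulrnDr.
rewrite big_split /= addrA; congr (_ + _).
rewrite [LHS]big_ord_recl /= bin0; congr (_ + _).
rewrite [RHS]big_ord_recr /= bin_small // mulr0n addr0.
by apply: eq_bigr => i _; rewrite /bump /= add1n subSS.
Qed.

(** Left multiplication by [d] is [ad d] plus right multiplication by [d]. These two operators
    commute, and in the binomial expansion of the [p]-th power of their sum only the two extreme
    terms survive. *)
Lemma pchar_expr_commutator (R : nzRingType) (p : nat) (d a : R) :
  p \in [pchar R] ->
  d ^+ p * a = a * d ^+ p + iter p (fun u => d * u - u * d) a.
Proof.
move=> chp; have p_gt0 := prime_gt0 (pcharf_prime chp).
pose S : {additive R -> R} := (d \*o idfun) \- (d \o* idfun).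
pose T : {additive R -> R} := d \o* idfun.
have ST v : S (T v) = T (S v) by rewrite /S /T /= mulrBl !mulrA.
have := @iter_addr_comm _ S T ST p a.
have -> n : iter n (fun u => S u + T u) a = d ^+ n * a.
  by elim: n => [|n IH] /=; rewrite ?mul1r // subrK IH exprS mulrA.
have Tn n v : iter n T v = v * d ^+ n.
  by elim: n => [|n IH] /=; rewrite ?mulr1 // IH -mulrA -exprSr.
case: p chp p_gt0 => // p chp _ ->; rewrite big_ord_recl big_ord_recr /=.
rewrite /bump /= add1n subnn bin0 binn !mulr1n Tn /=.
rewrite big1 => [|i _]; first by rewrite add0r addrC -mulrA -exprSr.
by rewrite add1n -mulr_natr bin_lt_pcharf_0 ?mulr0 //= ltnS ltn_ord.
Qed.

(** * Polynomials with zero derivative *)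

Lemma deriv_eq0_pchar0 (R : idomainType) (f : {poly R}) :
  [pchar R] =i pred0 -> f^`() = 0 -> f = (f`_0)%:P.
Proof.
move=> /pcharf0P ch0 df; apply/polyP=> -[|i]; rewrite coefC //=.
have := coef_deriv f i; rewrite df coef0 => /esym/eqP.
by rewrite -mulr_natr mulf_eq0 ch0 orbF => /eqP.
Qed.

(** Undoes the substitution of ['X^p] for ['X]; [size f] is a crude but sufficient bound. *)
Definition contract_poly (R : nzRingType) (p : nat) (f : {poly R}) : {poly R} :=
  \poly_(i < size f) f`_(p * i).

Lemma deriv_eq0_pchar (R : idomainType) (p : nat) (f : {poly R}) :
  p \in [pchar R] -> f^`() = 0 -> f = contract_poly p f \Po 'X^p.
Proof.
move=> chp df; have p_gt0 := prime_gt0 (pcharf_prime chp).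
apply/polyP=> i; rewrite coef_comp_poly_Xn // coef_poly.
case: (boolP (p %| i)%N) => [/dvdnP[k ->]|].
  rewrite mulnK // [(p * k)%N]mulnC; case: ltnP => // le.
  by rewrite nth_default // (leq_trans le) // leq_pmulr.
case: i => [|i ndvd]; first by rewrite dvdn0.
have := coef_deriv f i; rewrite df coef0 => /esym/eqP.
by rewrite -mulr_natr mulf_eq0 -(dvdn_pcharf chp) (negPf ndvd) orbF => /eqP.
Qed.

Lemma deriv_exp_pchar (R : comNzRingType) (p k : nat) (f : {poly R}) :
  p \in [pchar R] -> (f ^+ (p * k))^`() = 0.
Proof.
move=> chp; rewrite deriv_exp mulrnA (@mulrn_pchar _ p) ?mul0rn //.
by rewrite pchar_poly.
Qed.

Lemma deriv_comp_Xp (R : comNzRingType) (p : nat) (f : {poly R}) :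
  p \in [pchar R] -> (f \Po 'X^p)^`() = 0.
Proof.
move=> chp; rewrite deriv_comp derivXn (@mulrn_pchar _ p) ?mulr0 //.
by rewrite pchar_poly.
Qed.

(** * Normal forms and associativity in the Weyl algebra *)

Section Weyl.
Variable F : fieldType.
Implicit Types (f g h : {poly F}) (a b : {poly {poly F}}).

Definition wdx : {poly {poly F}} -> {poly {poly F}} := map_poly (@deriv F).
HB.instance Definition _ := GRing.Additive.on wdx.

Lemma coef_wdx a i : (wdx a)`_i = (a`_i)^`().
Proof. by rewrite coef_map. Qed.

Lemma wdxC f : wdx f%:P = f^`()%:P.
Proof. by rewrite /wdx map_polyC. Qed.

Lemma wdxM a b : wdx (a * b) = wdx a * b + a * wdx b.
Proof.
apply/polyP=> i; rewrite coefD coef_wdx !coefM raddf_sum -big_split /=.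
by apply: eq_bigr => j _; rewrite !coef_wdx derivM.
Qed.

Lemma wdxXn n : wdx 'X^n = 0.
Proof.
apply/polyP=> i; rewrite coef_wdx coefXn coef0.
by case: eqP; rewrite ?derivC ?deriv0.
Qed.

Definition wly a : {poly {poly F}} := 'X * a + wdx a.

Fact wly_is_zmod_morphism : zmod_morphism wly.
Proof. by move=> a b; rewrite /wly raddfB /= mulrBr opprD addrACA. Qed.
HB.instance Definition _ := GRing.isZmodMorphism.Build _ _ wly wly_is_zmod_morphism.

Lemma wlyCM f a : wly (f%:P * a) = f^`()%:P * a + f%:P * wly a.
Proof. by rewrite /wly wdxM wdxC mulrDr mulrCA addrCA. Qed.

Lemma iter_wly1 i : iter i wly 1 = 'X^i.
Proof. by elim: i => [|i IH] //=; rewrite IH /wly wdxXn addr0 exprS. Qed.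

Lemma iter_wly a n : iter n wly a =
  \sum_(k < n.+1) ('X^(n - k) * iter k wdx a) *+ 'C(n, k).
Proof.
have ST v : 'X * wdx v = wdx ('X * v).
  by rewrite wdxM -['X]expr1 wdxXn mul0r add0r.
rewrite (@iter_addr_comm _ ('X \*o idfun) (@wdx)) //.
apply: eq_bigr => k _; congr (_ *+ _).
by elim: (n - k)%N => [|m IH] /=; rewrite ?mul1r // IH exprS mulrA.
Qed.

Lemma wmulE a b : wmul a b = \sum_(i < size a) (a`_i)%:P * iter i wly b.
Proof.
apply: eq_bigr => i _; rewrite exchange_big /= iter_wly mulr_sumr.
apply: eq_bigr => k _.
have -> : iter k wdx b = \sum_(j < size b) ((b`_j)^`(k))%:P * 'X^j.
  elim: (val k) => [|m IH] /=.
    rewrite -[LHS]coefK poly_def; apply: eq_bigr => j _.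
    by rewrite mul_polyC.
  rewrite IH raddf_sum; apply: eq_bigr => j _ /=.
  by rewrite wdxM wdxXn mulr0 addr0 wdxC -derivnS.
rewrite mulr_sumr -sumrMnl mulr_sumr; apply: eq_bigr => j _.
(* Since [k <= i], the truncated difference [i + j - k] is [j + (i - k)]. *)
rewrite addnC -addnBA ?leq_ord // exprD mulrnAr polyCMn polyCM mulrnAl.
by congr (_ *+ _); rewrite [RHS]mulrCA !mulrA [_ * 'X^_]mulrC !mulrA.
Qed.

(** A common bound lets left factors of different sizes be expanded over one index range. *)
Lemma wmulEn n a b : (size a <= n)%N ->
  wmul a b = \sum_(i < n) (a`_i)%:P * iter i wly b.
Proof.
move=> le; rewrite wmulE (big_ord_widen n (fun i => (a`_i)%:P * iter i wly b)) //.
rewrite big_mkcond; apply: eq_bigr => i _ /=.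
by case: ltnP => // ?; rewrite nth_default // mul0r.
Qed.

Lemma wmulDl a b c : wmul (a + b) c = wmul a c + wmul b c.
Proof.
pose n := maxn (size a) (size b).
rewrite (@wmulEn n) ?size_polyD // (@wmulEn n a) ?leq_maxl //.
rewrite (@wmulEn n b) ?leq_maxr // -big_split /=.
by apply: eq_bigr => i _; rewrite coefD polyCD mulrDl.
Qed.

Lemma iter_wlyD i a b : iter i wly (a + b) = iter i wly a + iter i wly b.
Proof. by elim: i => //= i ->; rewrite raddfD. Qed.

Lemma wmulDr a b c : wmul a (b + c) = wmul a b + wmul a c.
Proof.
rewrite !wmulE -big_split /=.
by apply: eq_bigr => i _; rewrite iter_wlyD mulrDr.
Qed.

Lemma wmulCp f a : wmul f%:P a = f%:P * a.
Proof.
rewrite (@wmulEn 1) ?size_polyC_leq1 // big_ord_recl big_ord0 addr0.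
by rewrite coefC.
Qed.

Lemma wmul1r a : wmul a 1 = a.
Proof.
rewrite wmulE -[RHS]coefK poly_def; apply: eq_bigr => i _.
by rewrite iter_wly1 mul_polyC.
Qed.

Lemma wmulXl a : wmul 'X a = wly a.
Proof.
rewrite (@wmulEn 2) ?size_polyX // !big_ord_recl big_ord0 addr0 /=.
by rewrite !coefX /= mul0r add0r mul1r.
Qed.

Lemma wmulCpA f a b : wmul (f%:P * a) b = f%:P * wmul a b.
Proof.
rewrite (@wmulEn (size a)) ?wmulE ?mulr_sumr.
  by apply: eq_bigr => i _; rewrite coefCM polyCM mulrA.
by apply/leq_sizeP=> j lt; rewrite coefCM nth_default ?mulr0.
Qed.

(** Associativity for the left factor [y]. Applying [wly] to [a_i * L^i b] gives
    [a_i' * L^i b + a_i * L^(i+1) b]; the first terms sum to [wmul (wdx a) b], the shifted ones to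
    [wmul ('X * a) b]. *)
Lemma wmul_wly a b : wmul (wly a) b = wly (wmul a b).
Proof.
rewrite (wmulE a) raddf_sum /= {1}/wly wmulDl addrC.
under eq_bigr do rewrite wlyCM.
rewrite big_split /=; congr (_ + _).
  rewrite (@wmulEn (size a)) ?size_poly //.
  by apply: eq_bigr => i _; rewrite coef_wdx.
rewrite mulrC (@wmulEn (size a).+1) ?big_ord_recl ?coefMX ?mul0r ?add0r.
  by apply: eq_bigr => i _; rewrite coefMX.
by have [->|nz] := eqVneq a 0; rewrite ?mul0r ?size_poly0 // size_mulX.
Qed.

Lemma wmul0l b : wmul 0 b = 0.
Proof. by rewrite wmulE size_poly0 big_ord0. Qed.

Lemma wmulA : associative (@wmul F).
Proof.
move=> a b c; rewrite [LHS]wmulE [wmul a b]wmulE.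
elim/big_ind2: _ => [|u1 u2 v1 v2 -> ->|i _]; rewrite ?wmul0l ?wmulDl //.
rewrite wmulCpA; congr (_ * _).
by elim: (val i) => //= m ->; rewrite wmul_wly.
Qed.

(* An alias, since [weyl F] unfolds to [{poly {poly F}}] and so already carries
   the commutative product. *)
Definition weylR := {poly {poly F}}.
HB.instance Definition _ := GRing.Zmodule.on weylR.
Fact wmul1l : left_id (1 : weylR) (@wmul F).
Proof. by move=> a; rewrite -[1 in LHS]polyC1 wmulCp polyC1 mul1r. Qed.
Fact weylR1_neq0 : (1 : {poly {poly F}}) != 0 :> weylR.
Proof. exact: oner_neq0. Qed.
HB.instance Definition _ := GRing.Zmodule_isNzRing.Build weylR
  wmulA wmul1l wmul1r wmulDl wmulDr weylR1_neq0.

Lemma wmulRE a b : wmul a b = (a : weylR) * (b : weylR) :> weylR.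
Proof. by []. Qed.

Lemma wexpRE a n : wexp a n = (a : weylR) ^+ n :> weylR.
Proof. by elim: n => //= n IH; rewrite exprS -IH. Qed.

(** * Commutation with [x], [y] and polynomials *)

Lemma wmulX a : wmul a 'X = 'X * a.
Proof.
rewrite wmulE -[a in RHS]coefK poly_def mulr_sumr; apply: eq_bigr => i _.
rewrite -[X in iter _ _ X]expr1 -iter_wly1 -iterD addn1 iter_wly1.
by rewrite mul_polyC exprS -scalerAr.
Qed.

Lemma wmulYX a : wmul 'X a = wmul a 'X + wdx a.
Proof. by rewrite wmulXl wmulX. Qed.

Lemma wmul_x a : wmul a (wX F) = wmul (wX F) a + a^`().
Proof.
rewrite [wX F]/('X%:P) wmulCp wmulE.
(* The correction terms will assemble to the [Y]-derivative of [a]; at [i = 0] the truncated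
   exponent has multiplicity [0]. *)
have E i : iter i wly ('X : {poly F})%:P = 'X%:P * 'X^i + 'X^(i.-1) *+ i.
  elim: i => [|i IH] /=; first by rewrite mulr1 mulr0n addr0.
  rewrite IH raddfD /= wlyCM derivX mul1r -!iter_wly1 -iterS -addrA addrC.
  rewrite -addrA; congr (_ + _); rewrite raddfMn /= -iterS !iter_wly1 mulrSr.
  by case: i {IH} => [|i] //=; rewrite ?mulr0n.
under eq_bigr do rewrite E mulrDr.
rewrite big_split /=; congr (_ + _).
  rewrite -[a in RHS]coefK poly_def mulr_sumr; apply: eq_bigr => i _.
  by rewrite mulrCA -[in RHS]mul_polyC.
rewrite -[a in RHS]coefK poly_def raddf_sum /=; apply: eq_bigr => i _.
by rewrite derivZ derivXn mul_polyC.
Qed.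

(** Multiplication by a polynomial with zero derivative commutes with [L]. *)
Lemma wmul_constM f a b : f^`() = 0 -> wmul a (f%:P * b) = f%:P * wmul a b.
Proof.
move=> df; rewrite !wmulE mulr_sumr; apply: eq_bigr => i _.
rewrite mulrCA; congr (_ * _); elim: (val i) => //= m ->.
by rewrite wlyCM df mul0r add0r.
Qed.

Definition wC f : weylR := f%:P.
Definition wy : weylR := 'X.

Fact wC_is_zmod_morphism : zmod_morphism wC.
Proof. by move=> f g; rewrite /wC raddfB. Qed.
Fact wC_is_monoid_morphism : monoid_morphism wC.
Proof. by split=> // f g; rewrite -wmulRE wmulCp -polyCM. Qed.
HB.instance Definition _ := GRing.isZmodMorphism.Build _ _ wC wC_is_zmod_morphism.
HB.instance Definition _ := GRing.isMonoidMorphism.Build _ _ wC wC_is_monoid_morphism.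

Lemma wCmE f a : wC f * (a : weylR) = f%:P * a :> {poly {poly F}}.
Proof. by rewrite -wmulRE wmulCp. Qed.

Lemma wyXn n : wy ^+ n = 'X^n :> {poly {poly F}}.
Proof.
by elim: n => // n IH; rewrite exprSr -wmulRE wmulX IH exprS.
Qed.

Lemma wyC f : wy * wC f = wC f * wy + wC f^`().
Proof. by rewrite -wmulRE wmulYX wdxC. Qed.

Lemma pchar_weylR : [pchar weylR] =i [pchar F].
Proof. by move=> p; rewrite -(pchar_poly F) -(pchar_poly {poly F}). Qed.

Lemma wy_wC_commutator h f :
  wC h * wy * wC f - wC f * (wC h * wy) = wC (delta h f).
Proof.
rewrite -mulrA wyC mulrDr !mulrA -!rmorphM (mulrC f h) addrAC subrr.
exact: add0r.
Qed.

(** The extra factor [f] avoids the exponent [n - 1]. *)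
Lemma deriv_exp_mul f n : (f ^+ n)^`() * f = f ^+ n * (f^`() *+ n).
Proof.
rewrite deriv_exp mulrnAl mulrnAr [in RHS]mulrC; case: n => // n.
by rewrite -mulrA -exprSr.
Qed.

(** Valid in every characteristic: moving [y] left across [h^n] costs [(h^n)'], and
    [(h^n)' h = n h^n h'] is exactly what the summand [n h'] of the next factor supplies. *)
Lemma wprod_yhat h n :
  wprod [seq yhat h + wpoly (h^`() *+ i) | i <- iota 0 n]
  = wy ^+ n * wC h ^+ n :> weylR.
Proof.
have wprodE (s : seq weylR) : wprod s = \prod_(u <- s) u :> weylR.
  by elim: s => [|u s IH]; rewrite ?big_nil // big_cons -IH.
rewrite wprodE big_map -[n in iota _ n]subn0 -/(index_iota 0 n).
elim: n => [|n IH]; first by rewrite big_geq // mulr1.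
rewrite (@big_nat_recr _ _ _ n) //= IH.
rewrite -[yhat h + _]/(wy * wC h + wC (h^`() *+ n)) exprSr -!mulrA.
congr (_ * _); rewrite exprSr mulrA -!rmorphXn /= (wyC (h ^+ n)) mulrDr mulrDl.
by rewrite -mulrA -!rmorphM /= deriv_exp_mul !mulrA.
Qed.

Lemma comm_wC a f : a^`() = 0 -> GRing.comm (a : weylR) (wC f).
Proof.
move=> da; elim/poly_ind: f => [|f c IH]; first by rewrite raddf0; apply: commr0.
rewrite rmorphD rmorphM; apply: commrD; first apply: commrM => //.
  by rewrite /GRing.comm -!wmulRE wmul_x da addr0.
by have := @wmul_constM c%:P a 1 (derivC c); rewrite mulr1 wmul1r -wmulCp.
Qed.

(** * The subalgebra [A_h] and its center *)

Lemma Ah_wpoly h f : Ah h (wpoly f).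
Proof.
elim/poly_ind: f => [|f c IH].
  by have := Ah_scal h (0 : F); rewrite /wscal /wpoly polyC0.
have -> : wpoly (f * 'X + c%:P) = wmul (wpoly f) (wX F) + wscal c.
  by rewrite /wpoly polyCD polyCM wmulCp.
by apply: Ah_add; [apply: Ah_mul => //; exact: Ah_x | exact: Ah_scal].
Qed.

Lemma comm_Ah h a : a^`() = 0 -> wdx a = 0 ->
  forall b, Ah h b -> wmul a b = wmul b a.
Proof.
move=> da xa b.
suff aux : Ah h b -> GRing.comm (a : weylR) b by exact: aux.
elim=> [c|||u v _ cu _ cv|u v _ cu _ cv].
- exact: comm_wC.
- exact: comm_wC.
- apply: commrM; last exact: comm_wC.
  by rewrite /GRing.comm -!wmulRE wmulYX xa addr0.
- exact: commrD.
- exact: commrM.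
Qed.

Lemma center_Ah_deriv h a : h != 0 -> center_Ah h a -> a^`() = 0 /\ wdx a = 0.
Proof.
move=> hnz [_ ca].
have da : a^`() = 0.
  have := ca _ (Ah_x h); rewrite wmul_x => /eqP.
  by rewrite eq_sym addrC -subr_eq subrr eq_sym => /eqP.
(* The two partial derivatives commute, so [wdx a] also commutes with [h]. *)
have dxa : (wdx a)^`() = 0.
  apply/polyP=> i; rewrite coef_deriv coef_wdx -raddfMn /= -coef_deriv da.
  by rewrite !coef0 deriv0.
have yaE : (a : weylR) * wy + wdx a = wy * (a : weylR).
  by rewrite -[RHS]/(wmul 'X a) wmulYX.
(* Both [a y h] and [a y h + (wdx a) h = y a h] equal [y h a]. Once [h] is moved to the left, the
   product is that of the integral domain [{poly {poly F}}]. *)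
have xa0 : (wdx a : weylR) * wC h = 0.
  apply: (@addrI _ ((a : weylR) * wy * wC h)).
  rewrite addr0 -mulrDl yaE -mulrA -[LHS]mulrA (comm_wC h da) [LHS]mulrA.
  exact/esym/(ca _ (Ah_yhat h)).
split=> //; move/eqP: xa0; rewrite comm_wC // wCmE.
by rewrite mulf_eq0 polyC_eq0 (negPf hnz) => /eqP.
Qed.

Lemma Ah_dvd h a : Ah h a -> forall i, h ^+ i %| a`_i.
Proof.
pose B b := forall i, h ^+ i %| b`_i.
have BC f b : B b -> B (f%:P * b).
  by move=> Bb i; rewrite coefCM dvdp_mull.
have BD b c : B b -> B c -> B (b + c).
  by move=> Bb Bc i; rewrite coefD dvdp_add.
suff st : Ah h a -> forall b, B b -> B (wmul a b).
  move=> /st /(_ 1); rewrite wmul1r; apply=> i; rewrite coef1.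
  by case: i => [|i]; rewrite ?dvdp0.
(* [B] itself is awkward to multiply; its left stabiliser is a ring. *)
elim=> [c|||u v _ Bu _ Bv|u v _ Bu _ Bv] b Bb.
- by rewrite wmulCp; apply: BC.
- by rewrite wmulCp; apply: BC.
- rewrite -wmulA wmulCp wmulXl wlyCM; apply: BD; first exact: BC.
  move=> i; rewrite coefCM coefD coefXM coef_wdx mulrDr; apply: dvdp_add.
    by case: i => [|i] /=; rewrite ?mulr0 ?dvdp0 // exprS dvdp_mul.
  (* Differentiating [h^i] lowers its exponent by one, and the factor [h] in front restores it. *)
  have /dvdpP[q ->] := Bb i.
  rewrite derivM mulrDr; apply: dvdp_add; first by rewrite mulrA dvdp_mull.
  by rewrite mulrCA [h * _]mulrC deriv_exp_mul mulrCA dvdp_mulr.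
- by rewrite wmulDl; apply: BD; [apply: Bu | apply: Bv].
- by rewrite -wmulA; apply: Bu; apply: Bv.
Qed.

Lemma wexp_wpoly f n : wexp (wpoly f) n = (f ^+ n)%:P.
Proof. by rewrite wexpRE -[RHS]/(wC _) rmorphXn. Qed.

Lemma wexp_wY n : wexp (wY F) n = 'X^n.
Proof. by rewrite wexpRE wyXn. Qed.

Lemma Ah_sum h n (E : 'I_n -> weyl F) :
  (forall i, Ah h (E i)) -> Ah h (\sum_i E i).
Proof.
move=> AE; elim/big_ind: _ => //; last exact: Ah_add.
by have := Ah_wpoly h 0; rewrite /wpoly polyC0.
Qed.

Lemma Ah_exp h a n : Ah h a -> Ah h (wexp a n).
Proof.
move=> Aa; elim: n => [|n IH] /=; last exact: Ah_mul.
exact: (Ah_scal h 1).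
Qed.

(** * The center in characteristic [p] *)

Section Pchar.
Variables (p : nat) (h : {poly F}).
Hypothesis chp : p \in [pchar F].

Let p_gt0 : (0 < p)%N := prime_gt0 (pcharf_prime chp).
Let chpx : p \in [pchar {poly F}]. Proof. by rewrite pchar_poly. Qed.
Let chpp : p \in [pchar {poly {poly F}}]. Proof. by rewrite pchar_poly. Qed.

Definition hpyp : weyl F := wmul (wexp (wpoly h) p) (wexp (wY F) p).

Lemma hpypE : hpyp = (h ^+ p)%:P * 'X^p.
Proof. by rewrite /hpyp wexp_wpoly wmulCp wexp_wY. Qed.

Lemma hpyp_comm : hpyp = wmul (wexp (wY F) p) (wexp (wpoly h) p).
Proof.
rewrite hpypE wexp_wY wexp_wpoly -[X in wmul _ X]mulr1.
by rewrite wmul_constM ?wmul1r // -[p]muln1 deriv_exp_pchar.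
Qed.

Lemma hpyp_prod :
  hpyp = wprod [seq yhat h + wpoly (h^`() *+ i) | i <- iota 0 p].
Proof. by rewrite wprod_yhat hpyp_comm wmulRE !wexpRE. Qed.

Lemma wexp_hpyp n : wexp hpyp n = (h ^+ (p * n))%:P * 'X^(p * n).
Proof.
elim: n => [|n IH]; first by rewrite muln0 mulr1.
rewrite /= -/(wexp _ _) IH wmul_constM ?deriv_exp_pchar // hpypE wmulCpA.
rewrite -[X in wmul X _]wexp_wY -[X in wmul _ X]wexp_wY !wexpRE wmulRE -exprD.
by rewrite wyXn mulrA -polyCM -exprD mulnS addnC.
Qed.

(** As [h^p] has zero derivative, powers of [h^p y^p] are already in normal form, and evaluation
    becomes a commutative substitution. *)
Lemma weval2E P : weval2 P (wexp (wX F) p) hpyp =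
  (\poly_(i < size P) ((P`_i \Po 'X^p) * h ^+ (p * i))) \Po 'X^p.
Proof.
rewrite poly_def raddf_sum /=; apply: eq_bigr => i _.
rewrite comp_polyZ comp_Xn_poly -exprM -mul_polyC polyCM -mulrA -wexp_hpyp.
rewrite [P`_i \Po _]comp_polyE rmorph_sum mulr_suml /=.
apply: eq_bigr => j _; rewrite wmulCp (wexp_wpoly 'X) (wexp_wpoly 'X^p) wmulCp.
by rewrite mulrA -polyCM -[in RHS]mul_polyC.
Qed.

Lemma coef_weval2 P k : (weval2 P (wexp (wX F) p) hpyp)`_k =
  if (p %| k)%N then (P`_(k %/ p) \Po 'X^p) * h ^+ k else 0.
Proof.
rewrite weval2E coef_comp_poly_Xn // coef_poly; case: ifP => // dv.
rewrite [(p * _)%N]mulnC divnK //; case: ltnP => // le.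
by rewrite nth_default // comp_poly0 mul0r.
Qed.

(** Distinct outer exponents [i] reach distinct powers [y^(p i)], so each [P_i(x^p)] is read off
    after cancelling [h^(p i)]. *)
Lemma weval2_inj P : h != 0 -> weval2 P (wexp (wX F) p) hpyp = 0 -> P = 0.
Proof.
move=> hnz P0; apply/polyP=> i; rewrite coef0.
have := coef_weval2 P (p * i); rewrite P0 coef0 dvdn_mulr // mulKn // => /esym/eqP.
rewrite mulf_eq0 expf_eq0 (negPf hnz) andbF orbF => /eqP Pi.
apply/polyP=> j; have := coef_comp_poly_Xn P`_i (p * j) p_gt0.
by rewrite Pi !coef0 dvdn_mulr // mulKn.
Qed.

(** The product form exhibits membership, as [y] itself need not lie in [A_h]. *)
Lemma Ah_hpyp : Ah h hpyp.
Proof.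
rewrite hpyp_prod; elim: (iota 0 p) => [|i s IH] /=; first exact: (Ah_scal h 1).
by apply: Ah_mul IH; apply: Ah_add; [exact: Ah_yhat | exact: Ah_wpoly].
Qed.

Lemma center_AhP a : h != 0 -> center_Ah h a <->
  exists P : {poly {poly F}}, a = weval2 P (wexp (wX F) p) hpyp.
Proof.
move=> hnz; split=> [ca|[P ->]].
  have [da xa] := center_Ah_deriv hnz ca.
  (* Strip [h^(p i)] from the coefficient of [y^(p i)], then replace [x^p] by the inner variable. *)
  exists (\poly_(i < size a) contract_poly p (a`_(p * i) %/ h ^+ (p * i))).
  apply/polyP=> k; rewrite coef_weval2 {1}(deriv_eq0_pchar chpx da).
  rewrite coef_comp_poly_Xn // !coef_poly.
  case: ifP => // /dvdnP[i ->]; rewrite mulnK // [(i * p)%N]mulnC.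
  case: ifP => _; last first.
    by rewrite comp_poly0 mul0r.
  have /divpK aE := Ah_dvd ca.1 (p * i).
  rewrite -deriv_eq0_pchar ?aE //; apply/eqP.
  (* The quotient has zero derivative, because both [h^(p i)] and its product with the quotient
     do. *)
  have := coef_wdx a (p * i); rewrite xa coef0 -{1}aE derivM deriv_exp_pchar //.
  rewrite mulr0 addr0 => /esym/eqP; rewrite mulf_eq0 expf_eq0 (negPf hnz) andbF.
  by rewrite orbF.
split.
  apply: Ah_sum => i; apply: Ah_sum => j; apply: Ah_mul; first exact: Ah_scal.
  by apply: Ah_mul; do 2?apply: Ah_exp; [exact: Ah_x | exact: Ah_hpyp].
apply: comm_Ah; first by rewrite weval2E deriv_comp_Xp.
apply/polyP=> k; rewrite coef_wdx coef_weval2 coef0.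
case: ifP => [/dvdnP[i ->]|_]; last by rewrite deriv0.
by rewrite derivM deriv_comp_Xp // mul0r mulnC deriv_exp_pchar // mulr0 addr0.
Qed.

(** * The [p]-th powers of [h y] and [y h] *)

Lemma dvdp_delta : h %| iter p (delta h) 'X.
Proof. by rewrite -(prednK p_gt0) /= /delta dvdp_mulr. Qed.

(** Each left factor [h y] raises the [Y]-degree by one and multiplies the top coefficient by [h];
    the derivative term stays below. *)
Lemma coef_exp_wy_wC n i : (n <= i)%N ->
  (((wC h * wy) ^+ n : {poly {poly F}}))`_i = (h ^+ n) *+ (i == n).
Proof.
elim: n i => [|n IH] i le; first by rewrite coef1.
rewrite exprS -mulrA wCmE coefCM -wmulRE wmulXl coefD coefXM coef_wdx.
case: i le => // i le; rewrite [LHS]/= (IH i) // (IH i.+1 (ltnW le)) eqSS.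
by rewrite (gtn_eqF le) mulr0n deriv0 addr0 mulrnAr exprS.
Qed.

Let q := iter p (delta h) 'X %/ h.

Lemma exp_wy_wC : (wC h * wy) ^+ p = wC (h ^+ p) * wy ^+ p + wC q * (wC h * wy).
Proof.
set D := wC h * wy; pose E : weylR := D ^+ p - wC q * D.
suff EE : E = wC (h ^+ p) * wy ^+ p by rewrite -EE subrK.
have chw : p \in [pchar weylR] by rewrite pchar_weylR.
(* The commutator of [D^p] with [x] is [delta^p(x) = q h], that of [q D] is also [q h]. *)
have Ex : E * wC 'X = wC 'X * E.
  have it n : iter n (fun u => D * u - u * D) (wC 'X) = wC (iter n (delta h) 'X).
    by elim: n => //= n ->; rewrite wy_wC_commutator.
  have Dx : D * wC 'X = wC 'X * D + wC h.
    have := wy_wC_commutator h 'X; rewrite /delta derivX mulr1 => <-.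
    by rewrite addrC subrK.
  rewrite mulrBl mulrBr pchar_expr_commutator // it -mulrA Dx mulrDr -rmorphM /=.
  rewrite divpK ?dvdp_delta // opprD addrACA subrr addr0.
  by rewrite !mulrA -!rmorphM /= [q * _]mulrC.
have dE : (E : {poly {poly F}})^`() = 0.
  by apply: (@addrI _ (wmul (wX F) E)); rewrite addr0 -wmul_x; exact: Ex.
(* Both terms of [E] end in a right factor [y], which leaves no [y^0] term. *)
have E0 : (E : {poly {poly F}})`_0 = 0.
  have -> : E = (D ^+ p.-1 * wC h - wC q * wC h) * wy.
    by rewrite mulrBl -!mulrA -exprSr prednK.
  by rewrite -wmulRE wmulX coefXM.
apply/polyP=> i; rewrite wCmE wyXn coefCM coefXn.
(* From degree [p] on, only [D^p] contributes, since [q D] has degree at most [1 < p]. For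
   [0 < i < p], [i] is invertible and [dE] kills the coefficient. *)
have [le|lt] := leqP p i.
  rewrite coefB coef_exp_wy_wC // wCmE coefCM -(expr1 D) coef_exp_wy_wC; last first.
    exact: leq_trans p_gt0 le.
  rewrite mulr_natr; have p_gt1 := prime_gt1 (pcharf_prime chp).
  by rewrite (gtn_eqF (leq_trans p_gt1 le)) mulr0 subr0.
rewrite (ltn_eqF lt) mulr0; case: i lt => // i lt.
have := coef_deriv E i; rewrite dE coef0 => /esym/eqP.
rewrite -mulr_natr mulf_eq0 -(dvdn_pcharf chpx) [(p %| _)%N]gtnNdvd //.
by rewrite orbF => /eqP.
Qed.

Lemma hpyp_yhat : h != 0 -> hpyp = wexp (yhat h) p - wmul (wpoly q) (yhat h).
Proof.
move=> hnz; have hyE n : wC h * (wy * wC h) ^+ n = (wC h * wy) ^+ n * wC h.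
  elim: n => [|n IH]; first by rewrite mulr1 mul1r.
  by rewrite exprSr mulrA IH exprSr !mulrA.
have dh : hpyp^`() = 0.
  by rewrite hpypE derivM derivC mul0r add0r derivXn (mulrn_pchar chpp) mulr0.
have hE : hpyp = wC (h ^+ p) * wy ^+ p :> weylR by rewrite hpypE wCmE wyXn.
(* The identity is proved after left multiplication by [h], which turns [y h] into [h y] and can be
   cancelled. *)
have E : wC h * hpyp = wC h * ((wy * wC h) ^+ p - wC q * (wy * wC h)).
  rewrite mulrBr hyE exp_wy_wC -hE mulrDl (comm_wC h dh).
  suff -> : wC q * (wC h * wy) * wC h = wC h * (wC q * (wy * wC h)) by rewrite addrK.
  by rewrite !mulrA -!rmorphM /= [q * h]mulrC.
apply: (@mulfI _ h%:P); first by rewrite polyC_eq0.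
by rewrite -!wCmE E wexpRE.
Qed.
End Pchar.
End Weyl.

Theorem theorem5p3 (F : fieldType) (h : {poly F}) (hnz : h != 0) :
  ([pchar F] =i pred0 ->
     forall a : weyl F, center_Ah h a <-> exists c : F, a = wscal c)
  /\
  (forall p : nat, p \in [pchar F] ->
     let xp := wexp (wX F) p in
     let hpyp := wmul (wexp (wpoly h) p) (wexp (wY F) p) in
     (forall P : {poly {poly F}}, weval2 P xp hpyp = 0 -> P = 0)
     /\ (forall a : weyl F, center_Ah h a <-> exists P : {poly {poly F}}, a = weval2 P xp hpyp)
     /\ h %| iter p (delta h) 'X
     /\ hpyp = wmul (wexp (wY F) p) (wexp (wpoly h) p)
     /\ hpyp = wprod [seq yhat h + wpoly (h^`() *+ i) | i <- iota 0 p]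
     /\ hpyp = wexp (yhat h) p - wmul (wpoly (iter p (delta h) 'X %/ h)) (yhat h)).
Proof.
split=> [ch0 a | p chp].
  split=> [/(center_Ah_deriv hnz)[da xa]|[c ->]].
    have ch0x : [pchar {poly F}] =i pred0 by move=> p; rewrite pchar_poly ch0.
    (* The vanishing [Y]-derivative leaves only the [y^0] coefficient, which [wdx a = 0] makes
       constant. *)
    exists a`_0`_0; rewrite {1}(deriv_eq0_pchar0 ch0x da) /wscal.
    by rewrite -(deriv_eq0_pchar0 ch0) // -coef_wdx xa coef0.
  split; first exact: Ah_scal.
  by apply: comm_Ah; rewrite ?derivC // wdxC derivC.
split; first by move=> P; apply: weval2_inj.
split; first by move=> a; apply: center_AhP.
split; first exact: dvdp_delta.
split; first exact: hpyp_comm.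
by split; [exact: hpyp_prod | exact: hpyp_yhat].
Qed.
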